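(* Let $q$ be a prime power, $\Delta$ an $n\times n$ diagonal matrix over $\mathbb{F}_q$ with distinct diagonal entries, and $\mu=(\mu_1,\dots,\mu_k)$ a partition with positive parts. The number of subspaces of $\mathbb{F}_q^n$ with partial $\Delta$-profile $\mu$ is $$\pi_n(\mu)=(q-1)^{\sum_{j\ge2}\mu_j}q^{\sum_{j\ge2}\binom{\mu_j}{2}}\sum_{T}c_q(T)\,q^{\gamma_n(T)},$$ the sum over all multilinear tableaux $T$ of shape $\mu'$ (the conjugate of $\mu$) whose support is contained in $[n]$.
   Context: $W$ has partial $\Delta$-profile $\mu$ if $\dim(W+\Delta W+\dots+\Delta^{j-1}W)=\mu_1+\dots+\mu_j$ for $1\le j\le k$. A multilinear tableau of shape $\lambda=(\lambda_1,\dots,\lambda_r)$ is an array $(T_{ij})$ of distinct positive integers with rows increasing left to right and columns increasing top to bottom; its support $\mathrm{supp}(T)$ is its set of entries. For $2\le j\le\lambda_i$, $c_{ij}(T)=\#\{i'\ge i:\text{cell }(i',j-1)\text{ exists and }T_{i',j-1}<T_{ij}\}$, $c_q(T)=\prod_i\prod_{j=2}^{\lambda_i}[c_{ij}(T)]_q$ with $[a]_q=1+q+\dots+q^{a-1}$. For sets $C,C'\subset\mathbb{N}$, $\beta(C,C')=\#\{(c,c'):c\in C,c'\in C',c<c'\}$. If $C_{\mathrm{last}}$ is the set of entries of the last column of $T$, then $\gamma_n(T)=\beta(C_{\mathrm{last}},[n]\setminus\mathrm{supp}(T))$. *)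

(* Defs.v *)
From HB Require Import structures.
From mathcomp Require Import all_boot all_order all_algebra.

Set Implicit Arguments.
Unset Strict Implicit.
Unset Printing Implicit Defensive.

Import VectorInternalTheory.

(* Over a finite field there are finitely many subspaces: {vspace vT} is a
   subtype of the (finite) type of square matrices. *)
HB.instance Definition _ (F : finFieldType) (vT : vectType F) :=
  [Finite of {vspace vT} by <:].

(* Parts are indexed from 0: mu_(j+1) is nth 0 mu j. *)
Definition is_partition (mu : seq nat) : bool :=
  sorted geq mu && all (leq 1) mu.

(* mu'_(i+1) = #{j : mu_j >= i+1}, for 0 <= i < mu_1. *)
Definition conj_part (mu : seq nat) : seq nat :=
  mkseq (fun i => count (leq i.+1) mu) (head 0 mu).

Section Profile.
Local Open Scope ring_scope.

Definition mx_image (F : fieldType) (n : nat) (A : 'M[F]_n)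
    (W : {vspace 'cV[F]_n}) : {vspace 'cV[F]_n} :=
  (linfun (mulmx A) @: W)%VS.

Definition partial_profile (F : fieldType) (n : nat) (Delta : 'M[F]_n)
    (mu : seq nat) (W : {vspace 'cV[F]_n}) : bool :=
  [forall j : 'I_(size mu),
    \dim (\sum_(i < j.+1) mx_image (Delta ^+ i) W)%VS
      == (\sum_(i < j.+1) nth 0 mu i)%N].

End Profile.

(* Cells are indexed from 0: (i, j) here is the cell (i+1, j+1). *)
Definition cell (lambda : seq nat) : finType :=
  {i : 'I_(size lambda) & 'I_(nth 0 lambda i)}.

Definition row_of (lambda : seq nat) (c : cell lambda) : nat := tag c.
Definition col_of (lambda : seq nat) (c : cell lambda) : nat := tagged c.

(* Arrays with entries in {0, ..., n}; positivity of the entries, part of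
   [multilinear], then amounts to the support being contained in [n]. *)
Definition tableau (n : nat) (lambda : seq nat) : finType :=
  {ffun cell lambda -> 'I_n.+1}.

Section Tableaux.
Variables (n : nat) (lambda : seq nat).
Implicit Types (T : tableau n lambda) (c : cell lambda).

Definition multilinear T : bool :=
  [&& injectiveb T,
      [forall c, 0 < T c],
      [forall c, forall c',
        (row_of c == row_of c') && (col_of c < col_of c') ==> (T c < T c')]
    & [forall c, forall c',
        (col_of c == col_of c') && (row_of c < row_of c') ==> (T c < T c')]].

Definition supp T : {set 'I_n.+1} := [set T c | c in [set: cell lambda]].

Definition last_col T : {set 'I_n.+1} :=
  [set T c | c in [set c : cell lambda | (col_of c).+1 == head 0 lambda]].

Definition c_cell T c : nat :=
  #|[set c' : cell lambda | [&& row_of c <= row_of c',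
                                (col_of c').+1 == col_of c & T c' < T c]]|.

Definition qint (q a : nat) : nat := \sum_(i < a) q ^ i.

Definition c_q (q : nat) T : nat :=
  \prod_(c : cell lambda | 0 < col_of c) qint q (c_cell T c).

Definition beta (C C' : {set 'I_n.+1}) : nat :=
  #|[set p in setX C C' | p.1 < p.2]|.

(* The set [n] = {1, ..., n}. *)
Definition interval1n : {set 'I_n.+1} := [set x : 'I_n.+1 | 0 < x].

Definition gamma T : nat := beta (last_col T) (interval1n :\: supp T).

End Tableaux.

(* Main.v *)
(** Forget the first coordinate: a subspace [W] of F^(1+n) maps onto a subspace
[V] of F^n, and the Krylov sums [W_j = W + Delta W + ... + Delta^(j-1) W] map onto
the [V_j].  Hence [dim W_j - dim V_j] is 0 or 1 according to whether the first unit
vector [e] lies in [W_j], and the profile of [W] is that of [V] with one part raised,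
namely the first [j] at which [e] enters [W_j].  Shifting [Delta] so that it kills [e]
and is invertible on F^n, the subspaces [W] over [V] with [e] outside [W_j] are the
graphs of the functionals on [V] vanishing on the intersection of [V] with
[Delta V_(j-1)]; there are q^(nu_j) of them, [nu] being the profile of [V].
Iterating, the subspaces are counted by words in the letters 0, ..., k, the letter
[k] standing for "no part raised", weighted by products of differences
q^(nu_(l-1)) - q^(nu_l).  A word of nonzero weight is a lattice word, and lattice
words of content [mu] are the multilinear tableaux of shape [mu'], a letter being the
column of the corresponding entry; under this bijection the weights agree. *)

Require Import Defs.
From HB Require Import structures.
From mathcomp Require Import all_boot all_order all_algebra.
From mathcomp Require Import finfield zify.

Set Implicit Arguments.
Unset Strict Implicit.
Unset Printing Implicit Defensive.

Import GRing.Theory.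
Local Open Scope ring_scope.

(** * Krylov sums and profiles *)

(** Horner form of [W + f W + ... + f^(j-1) W], so that the next sum is [W] plus the image of the
    previous one. *)
Definition krylov (K : fieldType) (vT : vectType K) (f : 'End(vT))
    (W : {vspace vT}) (j : nat) : {vspace vT} :=
  iter j (fun X => (W + f @: X)%VS) 0%VS.

Lemma krylov_leS (K : fieldType) (vT : vectType K) (f : 'End(vT))
    (W : {vspace vT}) j : (krylov f W j <= krylov f W j.+1)%VS.
Proof.
elim: j => [|j IHj]; first exact: sub0v.
by rewrite addvS ?subvv // limgS.
Qed.

(** The sums increase with [j], so the extra term [a *: x], with [x] in one sum, stays in the next
    one; the reverse inclusion is the same argument with [- a]. *)
Lemma krylov_shift (K : fieldType) (vT : vectType K) (f g : 'End(vT))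
    (a : K) (W : {vspace vT}) j :
  (forall v, g v = f v + a *: v) -> krylov g W j = krylov f W j.
Proof.
have le_shift (h1 h2 : 'End(vT)) b : (forall v, h2 v = h1 v + b *: v) ->
    forall i, (krylov h2 W i <= krylov h1 W i)%VS.
  move=> h12; elim=> [|i IHi]; first exact: subvv.
  apply/subvP => _ /memv_addP[w Ww [_ /memv_imgP[x Xx ->] ->]].
  rewrite h12 addrA memvD //.
    by rewrite memv_add // memv_img // (subvP IHi).
  by rewrite memvZ // (subvP (krylov_leS h1 W i)) // (subvP IHi).
move=> gE; apply/eqP.
rewrite eqEsubv (le_shift _ _ _ gE) (le_shift _ _ (- a)) //.
by move=> v; rewrite gE scaleNr addrK.
Qed.

Lemma limg_krylov (K : fieldType) (aT rT : vectType K) (p : 'Hom(aT, rT))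
    (f : 'End(aT)) (g : 'End(rT)) (W : {vspace aT}) j :
  (forall v, p (f v) = g (p v)) ->
  (p @: krylov f W j)%VS = krylov g (p @: W)%VS j.
Proof.
move=> pf; elim: j => [|j IHj]; first exact: limg0.
rewrite /= limgD; congr (_ + _)%VS; rewrite -IHj -!limg_comp.
by apply: eq_in_limg => v _; rewrite !comp_lfunE /= pf.
Qed.

Lemma sum_mx_image (F : fieldType) n (A : 'M[F]_n) (W : {vspace 'cV[F]_n}) j :
  (\sum_(i < j) mx_image (A ^+ i) W)%VS = krylov (linfun (mulmx A)) W j.
Proof.
elim: j => [|j IHj]; first by rewrite big_ord0.
rewrite big_ord_recl /= -IHj limg_sum; congr (_ + _)%VS.
  rewrite -[RHS]lim1g; apply: eq_in_limg => v _.
  by rewrite !lfunE /= expr0 mul1mx.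
apply: eq_bigr => i _; rewrite /mx_image -limg_comp.
by apply: eq_in_limg => v _; rewrite comp_lfunE !lfunE /= exprS mulmxA.
Qed.

Definition profile (K : fieldType) (vT : vectType K) (k : nat) (f : 'End(vT))
    (W : {vspace vT}) : seq nat :=
  mkseq (fun j => \dim (krylov f W j.+1) - \dim (krylov f W j))%N k.

Lemma partial_profileE (F : fieldType) n (A : 'M[F]_n) mu W :
  partial_profile A mu W = (profile (size mu) (linfun (mulmx A)) W == mu).
Proof.
have dim_leS j := dimvS (krylov_leS (linfun (mulmx A)) W j).
apply/forallP/eqP => [prof|prof j].
  have dimE j : (j <= size mu)%N ->
      \dim (krylov (linfun (mulmx A)) W j) = (\sum_(i < j) nth 0 mu i)%N.
    case: j => [|j] lt_j; first by rewrite big_ord0 dimv0.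
    by have /eqP := prof (Ordinal lt_j); rewrite sum_mx_image.
  apply: (@eq_from_nth _ 0%N); rewrite size_mkseq // => j lt_j.
  rewrite nth_mkseq // !dimE //; last exact: ltnW.
  by rewrite big_ord_recr /= addKn.
rewrite sum_mx_image; apply/eqP; move: (ltn_ord j).
elim: {j}(nat_of_ord j).+1 => [|j IHj] lt_j; first by rewrite big_ord0 dimv0.
rewrite big_ord_recr /= -IHj ?(ltnW lt_j) //.
by rewrite -[mu in nth _ mu _]prof nth_mkseq // subnKC.
Qed.

(** * Adjoining one coordinate *)

Lemma lfun_mulmx (F : fieldType) m n (h : 'Hom('cV[F]_n, 'cV[F]_m)) :
  exists u : 'M[F]_(m, n), forall v, u *m v = h v.
Proof.
exists (\matrix_(i, j) h (delta_mx j 0) i 0) => v.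
rewrite [v in RHS]matrix_sum_delta linear_sum /=.
apply/matrixP => i j; rewrite !mxE summxE; apply: eq_bigr => l _.
by rewrite big_ord1 linearZ /= !mxE !ord1 mulrC.
Qed.

(** Let the columns of [B] be a basis of [U]. Annihilating [U] means [u *m B = 0], and right
    multiplication by [B] is onto because [B] has full column rank, so rank-nullity gives the size
    of its kernel. *)
Lemma card_annihilator (F : finFieldType) n (U : {vspace 'cV[F]_n}) :
  #|[set u : 'rV[F]_n | (U <= lker (linfun (mulmx u)))%VS]|
    = (#|F| ^ (n - \dim U))%N.
Proof.
pose B : 'M[F]_(n, \dim U) := \matrix_(i, j) ((vbasis U)`_j) i 0.
have rankB : \rank B = \dim U.
  rewrite -mxrank_tr; apply/eqP; apply: inj_row_free => v vB0.
  have /freeP freeU := basis_free (vbasisP U).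
  apply/rowP => j; rewrite mxE; apply: (freeU (fun i => v 0 i)) => {j}.
  apply/matrixP => i j; rewrite ord1 summxE.
  have /rowP/(_ i) := vB0; rewrite !mxE => vBi.
  by rewrite -[RHS]vBi; apply: eq_bigr => l _; rewrite !mxE.
have dim_rV m : \dim (fullv : {vspace 'rV[F]_m}) = m.
  by rewrite dimvf dim_matrix; apply: mul1n.
pose K : {vspace 'rV[F]_n} := lker (linfun (mulmxr B)).
have annE : [set u : 'rV[F]_n | (U <= lker (linfun (mulmx u)))%VS] =i K.
  move=> u; rewrite inE memv_ker lfunE /=; apply/idP/eqP => [Uu|uB].
    apply/rowP => j; rewrite !mxE.
    have /(subvP Uu) : (vbasis U)`_j \in U.
      by rewrite vbasis_mem // mem_nth // size_tuple.
    rewrite memv_ker lfunE /= => /eqP/matrixP/(_ 0 0); rewrite !mxE => uj.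
    by rewrite -[RHS]uj; apply: eq_bigr => l _; rewrite mxE.
  apply/subvP => x Ux; rewrite memv_ker lfunE /= (coord_vbasis Ux).
  rewrite linear_sum /= big1 // => j _; rewrite linearZ /=.
  suff -> : u *m (vbasis U)`_j = 0 by rewrite scaler0.
  apply/matrixP => i l; rewrite !ord1 !mxE.
  have /rowP/(_ j) := uB; rewrite !mxE => uj.
  by rewrite -[RHS]uj; apply: eq_bigr => r _; rewrite mxE.
rewrite (eq_card annE) card_vspace; congr (_ ^ _)%N.
have := limg_ker_dim (linfun (@mulmxr F 1 n (\dim U) B)) fullv.
rewrite capfv dim_rV.
move/(canRL (addnK _)) => ->; congr (_ - _)%N.
suff -> : limg (linfun (@mulmxr F 1 n (\dim U) B)) = fullv by rewrite dim_rV.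
apply/eqP; rewrite eqEsubv subvf; apply/subvP => t _.
have /row_fullP[B' BB'] : row_full B by rewrite /row_full rankB.
have -> : t = linfun (mulmxr B) (t *m B').
  by rewrite lfunE /= -mulmxA BB' mulmx1.
by rewrite memv_img ?memvf.
Qed.


(** * Projection onto the last [n] coordinates, and graphs of functionals *)

Definition proj_tail (F : fieldType) n :
    'Hom('cV[F]_(1 + n), 'cV[F]_n) := linfun dsubmx.
Definition head_vec (F : fieldType) n : 'cV[F]_(1 + n) := col_mx 1%:M 0.
(** For [u = 0] this is the inclusion of F^n as the last [n] coordinates. *)
Definition graph_map (F : fieldType) n (u : 'rV[F]_n) :
    'Hom('cV[F]_n, 'cV[F]_(1 + n)) :=
  linfun (mulmx (col_mx u 1%:M)).

Lemma graph_mapE (F : fieldType) n (u : 'rV[F]_n) v :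
  graph_map u v = col_mx (u *m v) v.
Proof. by rewrite lfunE /= mul_col_mx mul1mx. Qed.

Lemma proj_tailE (F : fieldType) n (x : 'cV[F]_(1 + n)) :
  proj_tail F n x = dsubmx x.
Proof. exact: lfunE. Qed.

Lemma lker_proj_tail (F : fieldType) n :
  lker (proj_tail F n) = <[head_vec F n]>%VS.
Proof.
apply/eqP; rewrite eqEsubv; apply/andP; split; apply/subvP => x.
  rewrite memv_ker proj_tailE => /eqP x0; apply/vlineP; exists (usubmx x 0 0).
  rewrite -[LHS]vsubmxK x0 scale_col_mx scaler0; congr col_mx.
  by rewrite [LHS]mx11_scalar scale_scalar_mx mulr1.
case/vlineP=> a ->; rewrite memv_ker linearZ /= proj_tailE col_mxKd scaler0.
exact: eqxx.
Qed.

Lemma head_vec_neq0 (F : fieldType) n : head_vec F n != 0.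
Proof.
apply/eqP => /(congr1 usubmx); rewrite col_mxKu linear0 => /matrixP/(_ 0 0)/eqP.
by rewrite !mxE oner_eq0.
Qed.

Lemma cap_head_vec (F : fieldType) n (X : {vspace 'cV[F]_(1 + n)}) :
  (X :&: <[head_vec F n]> != 0)%VS = (head_vec F n \in X).
Proof.
apply/idP/idP => [|Xe].
  rewrite -subv0; case/subvPn=> x; rewrite memv_cap memv0.
  case/andP=> Xx /vlineP[a xE] x0; rewrite xE in Xx x0.
  have a0 : a != 0 by apply: contraNneq x0 => ->; rewrite scale0r.
  by rewrite -[head_vec F n](scalerK a0) memvZ.
apply: contra (head_vec_neq0 F n) => /eqP X0; rewrite -memv0 -X0 memv_cap Xe.
exact: memv_line.
Qed.

(** The kernel of the projection is the line of [head_vec F n], which meets [W] in dimension 1 or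
    0. *)
Lemma dim_proj_tail (F : fieldType) n (W : {vspace 'cV[F]_(1 + n)}) :
  \dim W = (\dim (proj_tail F n @: W) + (head_vec F n \in W))%N.
Proof.
rewrite -(limg_ker_dim (proj_tail F n) W) lker_proj_tail addnC; congr addn.
rewrite -cap_head_vec; have := dimvS (capvSr W <[head_vec F n]>).
rewrite dim_vline head_vec_neq0.
by rewrite -dimv_eq0; case: (\dim _) => [|[]].
Qed.

(* A subspace over [V] that misses [head_vec F n] is the graph of a unique
   functional on [V], and it misses [head_vec F n] modulo [Y] iff this
   functional vanishes on [V :&: Y].  The functionals on [V] are represented
   by the row vectors that annihilate the complement [V^C]. *)
Lemma card_over_missing (F : finFieldType) n (V Y : {vspace 'cV[F]_n}) :
  #|[set W | ((proj_tail F n @: W)%VS == V)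
             && (head_vec F n \notin (W + graph_map 0 @: Y)%VS)]|
    = (#|F| ^ (\dim (V + Y) - \dim Y))%N.
Proof.
(* Functionals on [V] vanishing on [V :&: Y], extended by zero on [V^C], are exactly the row vectors
   annihilating [Z]. *)
pose Z := ((V :&: Y) + V^C)%VS.
have dimZ : (n - \dim Z = \dim (V + Y) - \dim Y)%N.
  have dimn : \dim (fullv : {vspace 'cV[F]_n}) = n.
    by rewrite dimvf dim_matrix; apply: muln1.
  have cap0 : (V :&: Y :&: V^C)%VS = 0%VS.
    by apply/eqP; rewrite -subv0 -(capv_compl V) capvS ?capvSl.
  have := dimv_sum_cap (V :&: Y)%VS (V^C)%VS.
  rewrite cap0 dimv0 addn0 -/Z => ->.
  rewrite dimv_compl dimn; have := dimv_sum_cap V Y.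
  have := dimvS (subvf V); rewrite dimn; have := dimvS (addvSr V Y).
  have := dimvS (capvSl V Y); lia.
rewrite -dimZ -card_annihilator.
set A := [set u : 'rV[F]_n | _].
have proj_sec u X : (proj_tail F n @: (graph_map u @: X))%VS = X.
  rewrite -limg_comp -[RHS]lim1g; apply: eq_in_limg => v _.
  by rewrite comp_lfunE graph_mapE proj_tailE col_mxKd id_lfunE.
have secV u W : W = (graph_map u @: V)%VS ->
    (head_vec F n \notin (W + graph_map 0 @: Y)%VS)
      = (V :&: Y <= lker (linfun (mulmx u)))%VS.
  move=> ->; apply/idP/subvP => [eW x|Yu].
    rewrite memv_cap memv_ker lfunE /= => /andP[Vx Yx].
    apply: contraNT eW => ux0; pose a := (u *m x) 0 0.
    have a0 : a != 0.
      by apply: contraNneq ux0 => a0; rewrite [_ *m _]mx11_scalar -/a a0 raddf0.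
    (* Scaling [x] to a vector [v] with [u v = 1] gives [(1, 0) = (u v, v) - (0, v)], with [v] in
       both [V] and [Y]. *)
    have -> : head_vec F n =
        graph_map u (a^-1 *: x) + graph_map 0 (- (a^-1 *: x)).
      rewrite !graph_mapE add_col_mx mul0mx addr0 subrr -scalemxAr.
      congr col_mx.
      by rewrite [u *m x]mx11_scalar -/a scale_scalar_mx mulVf.
    by rewrite memv_add // memv_img // ?memvN memvZ.
  apply/negP => /memv_addP[_ /memv_imgP[v Vv ->] [_ /memv_imgP[y Yy ->]]].
  rewrite !graph_mapE add_col_mx mul0mx addr0 => /eq_col_mx[uv1 vy0].
  have vE : v = - y by apply/eqP; rewrite -addr_eq0 -vy0.
  have : v \in (V :&: Y)%VS by rewrite memv_cap Vv vE memvN.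
  move/Yu; rewrite memv_ker lfunE /= -uv1 => /eqP/matrixP/(_ 0 0)/eqP.
  by rewrite !mxE oner_eq0.
rewrite -(card_in_imset (f := fun u => (graph_map u @: V)%VS) (D := A)).
  apply: eq_card => W; rewrite inE; apply/andP/imsetP => [[/eqP pW eW]|[u]].
    (* A linear section over [V] with values in [W], obtained from a pseudo-inverse of the
       projection restricted to [W]. *)
    have [s sW ps] : exists2 s : 'Hom('cV[F]_n, 'cV[F]_(1 + n)),
        (forall v, s v \in W) & forall v, v \in V -> (proj_tail F n) (s v) = v.
      exists (projv W \o ((proj_tail F n) \o projv W)^-1)%VF => [v|v].
        by rewrite comp_lfunE memv_proj.
      rewrite -pW => /memv_imgP[w Ww vE].
      have : v \in limg ((proj_tail F n) \o projv W)%VF.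
        rewrite vE -[w in proj_tail F n w](projv_id Ww) -comp_lfunE.
        by rewrite memv_img ?memvf.
      by move/limg_lfunVK; rewrite !comp_lfunE.
    have eNW : head_vec F n \notin W.
      by apply: contra eW; apply/subvP; apply: addvSl.
    (* [u] reads off the first coordinate of the section; composing with [projv V] makes it vanish
       on [V^C]. *)
    have [u uE] := lfun_mulmx (linfun usubmx \o s \o projv V)%VF.
    have sE v : v \in V -> graph_map u v = s v.
      move=> Vv; rewrite graph_mapE uE !comp_lfunE projv_id // lfunE /=.
      by rewrite -[RHS]vsubmxK -[dsubmx _]proj_tailE ps.
    have WE : W = (graph_map u @: V)%VS.
      apply/eqP; rewrite eq_sym eqEdim; apply/andP; split.
        by apply/subvP => _ /memv_imgP[v Vv ->]; rewrite sE.
      rewrite (dim_proj_tail W) pW (negPf eNW) addn0 -{1}(proj_sec u V).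
      by rewrite -(limg_ker_dim (proj_tail F n) (graph_map u @: V)) leq_addl.
    exists u => //; rewrite inE subv_add -(secV u W) // eW.
    rewrite -lker_proj; apply/subvP => x; rewrite memv_ker => /eqP Vx0.
    by rewrite memv_ker lfunE /= uE comp_lfunE Vx0 linear0.
  rewrite inE subv_add => /andP[Yu _] WE.
  have pW : (proj_tail F n @: W)%VS = V by rewrite WE proj_sec.
  by rewrite (secV u W) ?pW.
(* Injectivity: equal graphs force agreement on [V], and both row vectors kill [V^C]. *)
move=> u v; rewrite !inE !subv_add => /andP[_ /subvP Cu] /andP[_ /subvP Cv] uv.
suff uvE (x : 'cV[F]_n) : u *m x = v *m x.
  apply/rowP => i; have /matrixP/(_ 0 0) := uvE (delta_mx i 0).
  by rewrite -!colE !mxE.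
have uvV (w : 'cV[F]_n) : w \in V -> u *m w = v *m w.
  move=> Vw; have : graph_map u w \in (graph_map v @: V)%VS.
    by rewrite -uv memv_img.
  by case/memv_imgP=> w' _; rewrite !graph_mapE => /eq_col_mx[-> ->].
have xC := memv_projC V x.
rewrite -[x](subrK (projv V x)) [u *m _]mulmxDr [v *m _]mulmxDr.
rewrite [u *m projv V x]uvV ?memv_proj //.
have := Cu _ xC; rewrite memv_ker lfunE /= => /eqP ->.
by have := Cv _ xC; rewrite memv_ker lfunE /= => /eqP ->.
Qed.

Local Close Scope ring_scope.

(* Adjoining one coordinate raises the part [l] of the profile in [step q k nu l]
   ways; [l = k] stands for the profile being unchanged up to its [k]-th part. *)
Definition step (q k : nat) (nu : seq nat) (l : nat) : nat :=
  if l is l'.+1 then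
    if l < k then q ^ nth 0 nu l' - q ^ nth 0 nu l else q ^ nth 0 nu l'
  else 1.

Definition add_part (k : nat) (nu : seq nat) (l : nat) : seq nat :=
  mkseq (fun j => nth 0 nu j + (j == l)) k.

(** * Counting the subspaces over a fixed [V] by the part that is raised *)

Section Fibre.
Local Open Scope ring_scope.
Variables (F : finFieldType) (n k : nat) (a : F).
Variables (f : 'End('cV[F]_(1 + n))) (g g0 : 'End('cV[F]_n)).
Hypothesis k_gt0 : (0 < k)%N.
(** Here [a] plays the first diagonal entry: subtracting it from [f] leaves a map that kills the
    first unit vector and acts through [g0] on the other coordinates. *)
Hypothesis g_shift : forall v, g v = g0 v + a *: v.
Hypothesis f_shift :
  forall x, f x = graph_map 0 (g0 (proj_tail F n x)) + a *: x.
Hypothesis g0_inj : lker g0 = 0%VS.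
Variable V : {vspace 'cV[F]_n}.

(** The default of [find] matters: the value is [k] when the first unit vector lies in none of the
    first [k] sums. *)
Let level W := find (fun j => head_vec F n \in krylov f W j.+1) (iota 0 k).

Let level_le W : (level W <= k)%N.
Proof. by rewrite /level (leq_trans (find_size _ _)) ?size_iota. Qed.

Let proj_f x : proj_tail F n (f x) = g (proj_tail F n x).
Proof.
by rewrite f_shift linearD linearZ /= g_shift graph_mapE proj_tailE col_mxKd.
Qed.

Let krylov_mono W i j : (i <= j)%N -> (krylov f W i <= krylov f W j)%VS.
Proof.
move/subnK <-; elim: (j - i)%N => [|d IHd]; first exact: subvv.
exact: subv_trans IHd (krylov_leS _ _ _).
Qed.

Let mem_krylov W j : (j <= k)%N ->
  (head_vec F n \in krylov f W j) = (level W < j)%N.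
Proof.
case: j => [_|j lt_jk].
  by rewrite memv0 (negPf (head_vec_neq0 F n)).
rewrite ltnS; case: leqP => [le_lj|lt_jl].
  have has_l : has (fun j => head_vec F n \in krylov f W j.+1) (iota 0 k).
    by rewrite has_find size_iota (leq_ltn_trans le_lj).
  have := nth_find 0%N has_l; rewrite nth_iota ?add0n; last first.
    exact: leq_ltn_trans le_lj lt_jk.
  by apply/subvP; apply: krylov_mono.
by have := before_find 0%N lt_jl; rewrite nth_iota.
Qed.

(** By [dim_proj_tail], the [j]-th dimension exceeds that of [V] by 1 exactly when [level W < j];
    taking differences leaves a single extra 1, at index [level W]. *)
Let profile_level W : (proj_tail F n @: W)%VS = V ->
  profile k f W = add_part k (profile k g V) (level W).
Proof.
move=> pW; apply: (@eq_from_nth _ 0%N); rewrite !size_mkseq // => j lt_jk.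
rewrite !nth_mkseq // !dim_proj_tail !(limg_krylov _ _ proj_f) pW.
rewrite !mem_krylov //; last exact: ltnW.
have := dimvS (krylov_leS g V j); move: (\dim _) (\dim _) => d1 d2.
by case: (ltngtP j (level W)); lia.
Qed.

Let card_level_ge j : (j < k)%N ->
  #|[set W | ((proj_tail F n @: W)%VS == V) && (j < level W)%N]|
    = (#|F| ^ nth 0 (profile k g V) j)%N.
Proof.
move=> lt_jk; rewrite nth_mkseq //.
pose Y := (g0 @: krylov g0 V j)%VS.
have dimY : \dim Y = \dim (krylov g V j).
  by rewrite (krylov_shift _ _ g_shift) /Y limg_dim_eq // g0_inj capv0.
have VY : (V + Y)%VS = krylov g V j.+1 by rewrite (krylov_shift _ _ g_shift).
rewrite -VY -dimY -card_over_missing; apply: eq_card => W; rewrite !inE.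
case: eqP => //= pW; rewrite ltnNge -ltnS -mem_krylov //; congr (_ \notin _).
(* After the shift, [f0] factors through the projection, so [W] enters the second summand of its
   Krylov sum only through [V]. This is the form [W + graph_map 0 @: Y] of [card_over_missing]. *)
pose f0 : 'End('cV[F]_(1 + n)) := (graph_map 0 \o g0 \o proj_tail F n)%VF.
have f0E x : f x = f0 x + a *: x by rewrite f_shift !comp_lfunE.
have pf0 x : proj_tail F n (f0 x) = g0 (proj_tail F n x).
  by rewrite !comp_lfunE graph_mapE proj_tailE col_mxKd.
rewrite (krylov_shift _ _ f0E) /= [X in (W + X)%VS]limg_comp limg_comp.
by rewrite (limg_krylov _ _ pf0) pW.
Qed.

(** A subspace over [V] that contains the kernel of the projection is the full preimage of [V]. *)
Let card_level0 :
  #|[set W | ((proj_tail F n @: W)%VS == V) && (level W == 0)%N]| = 1%N.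
Proof.
apply: etrans (cards1 (proj_tail F n @^-1: V)%VS).
apply: eq_card => W; rewrite !inE.
have W0 : (level W == 0)%N = (head_vec F n \in W).
  by rewrite -leqn0 -ltnS -mem_krylov //= limg0 addv0.
have V_sub : (V <= limg (proj_tail F n))%VS.
  apply/subvP => v _; have -> : v = proj_tail F n (col_mx 0 v).
    by rewrite proj_tailE col_mxKd.
  by rewrite memv_img ?memvf.
rewrite W0; apply/andP/eqP => [[/eqP pW We]|->].
  apply/eqP; rewrite eqEdim; apply/andP; split.
    by apply/subvP => w Ww; rewrite -memv_preim -pW memv_img.
  rewrite (dim_proj_tail W) We pW dim_proj_tail lpreimK // leq_add2l.
  exact: leq_b1.
by rewrite lpreimK // eqxx -memv_preim proj_tailE col_mxKd mem0v.
Qed.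

(** The level sets are differences of consecutive sets counted by [card_level_ge]; for [l = k]
    nothing is subtracted, as no level exceeds [k]. *)
Let card_level l : (l <= k)%N ->
  #|[set W | ((proj_tail F n @: W)%VS == V) && (level W == l)]|
    = step #|F| k (profile k g V) l.
Proof.
case: l => [|l] lt_lk; first exact: card_level0.
rewrite /step -card_level_ge //.
have [lt_Slk|le_kl] := ltnP l.+1 k.
  rewrite -[X in (_ - X)%N]card_level_ge // -cardsDS; last first.
    by apply/subsetP => W; rewrite !inE => /andP[-> /ltnW].
  apply: eq_card => W; rewrite !inE; case: eqP => //= _.
  by case: ltngtP; lia.
apply: eq_card => W; rewrite !inE; case: eqP => //= _.
by have := level_le W; lia.
Qed.

Lemma sum_profile_fibre (Phi : seq nat -> nat) :
  (\sum_(W | (proj_tail F n @: W)%VS == V) Phi (profile k f W))%N =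
  (\sum_(l < k.+1) step #|F| k (profile k g V) l
                   * Phi (add_part k (profile k g V) l))%N.
Proof.
rewrite (partition_big (fun W => inord (level W) : 'I_k.+1) xpredT) //=.
apply: eq_bigr => l _; rewrite -card_level ?leq_ord // -sum1_card big_distrl /=.
have inordE W : (inord (level W) == l) = (level W == l).
  by rewrite -val_eqE /= inordK ?ltnS.
rewrite [RHS](eq_bigl (fun W => ((proj_tail F n @: W)%VS == V) &&
    (inord (level W) == l))); last by move=> W; rewrite inE inordE.
apply: eq_bigr => W /andP[/eqP pW]; rewrite inordE => /eqP lW.
by rewrite mul1n profile_level // lW.
Qed.
End Fibre.

Lemma sum_profile_cons (F : finFieldType) n k (A : 'M[F]_(1 + n))
    (Phi : seq nat -> nat) :
  0 < k -> is_diag_mx A -> injective (fun i => A i i) ->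
  \sum_(W : {vspace 'cV[F]_(1 + n)}) Phi (profile k (linfun (mulmx A)) W) =
  \sum_(V : {vspace 'cV[F]_n}) \sum_(l < k.+1)
    let nu := profile k (linfun (mulmx (drsubmx A))) V in
    step #|F| k nu l * Phi (add_part k nu l).
Proof.
move=> k_gt0 /is_diag_mxP diagA injA.
rewrite (partition_big (fun W => (proj_tail F n @: W)%VS) xpredT) //=.
pose a : F := A 0%R 0%R.
apply: eq_bigr => V _.
pose g0 : 'End('cV[F]_n) := linfun (mulmx (drsubmx A - a%:M)%R).
apply: (@sum_profile_fibre F n k a _ _ g0) => //.
- by move=> v; rewrite !lfunE /= mulmxBl mul_scalar_mx subrK.
- move=> x; rewrite graph_mapE mul0mx !lfunE /=.
  rewrite -[X in mulmx A X]vsubmxK -[A in LHS]submxK mul_block_col.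
  have -> : (ursubmx A = 0)%R.
    by apply/matrixP => i j; rewrite !mxE diagA // ord1.
  have -> : (dlsubmx A = 0)%R.
    by apply/matrixP => i j; rewrite !mxE diagA // ord1.
  have -> : (ulsubmx A = a%:M)%R.
    rewrite [LHS]mx11_scalar; congr (_%:M)%R.
    by rewrite !mxE /a; congr (A _ _); apply: val_inj.
  rewrite !mul0mx addr0 add0r -[x in (_ *: x)%R]vsubmxK scale_col_mx add_col_mx.
  by rewrite add0r mulmxBl !mul_scalar_mx subrK.
(* Injectivity of [g0]: its diagonal entries are differences of distinct diagonal entries of [A],
   hence nonzero. *)
apply/eqP; rewrite -subv0; apply/subvP => v; rewrite memv_ker lfunE /= memv0.
move/eqP/matrixP => Av0; apply/eqP/matrixP => i j; rewrite ord1 mxE.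
have := Av0 i 0%R; rewrite !mxE (bigD1 i) //= big1 ?addr0 => [|l li].
  rewrite !mxE eqxx mulr1n => /eqP; rewrite mulf_eq0 subr_eq0 => /orP[|/eqP //].
  by move/eqP/injA/(congr1 val).
rewrite !mxE diagA ?(eq_sym i) ?(negPf li) ?subr0 ?mul0r //.
by rewrite /= eqSS eq_sym.
Qed.

(** * Words *)

(** Words become total functions, so that prefixes of words of different lengths can be compared;
    the default [k] is the letter that raises no part. *)
Definition letter n k (w : {ffun 'I_n -> 'I_k.+1}) (p : nat) : nat :=
  if insub p is Some i then w i else k.

Definition cnt (x : nat -> nat) (j p : nat) : nat := \sum_(i < p) (x i == j).

Definition content (k : nat) (x : nat -> nat) (p : nat) : seq nat :=
  mkseq (fun j => cnt x j p) k.

Definition weight (q k : nat) (x : nat -> nat) (n : nat) : nat :=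
  \prod_(p < n) step q k (content k x p) (x p).

Lemma cntS x j p : cnt x j p.+1 = cnt x j p + (x p == j).
Proof. exact: big_ord_recr. Qed.

Lemma cnt_le x j p p' : p <= p' -> cnt x j p <= cnt x j p'.
Proof.
move/subnK <-; elim: (p' - p) => // d; rewrite addSn cntS; lia.
Qed.

Lemma cnt_lt x p p' : p < p' -> cnt x (x p) p < cnt x (x p) p'.
Proof. by move/(cnt_le x (x p)); rewrite cntS eqxx addn1. Qed.

(** The count of [j] grows by at most one at each position, so it passes through every value; [p] is
    the position of occurrence number [i.+1] of [j]. *)
Lemma cnt_surj x j n i : i < cnt x j n ->
  exists2 p, p < n & x p = j /\ cnt x j p = i.
Proof.
elim: n => [|n IHn]; first by rewrite /cnt big_ord0.
rewrite cntS; have [lt_i _|le_ni] := ltnP i (cnt x j n).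
  by have [p lt_p ?] := IHn lt_i; exists p; first exact: ltnW.
by case: eqP => [xn lt_i|_]; [exists n => //; split => //; lia | lia].
Qed.

Lemma eq_cnt x y j p : (forall i, i < p -> x i = y i) -> cnt x j p = cnt y j p.
Proof. by move=> xy; apply: eq_bigr => i _; rewrite xy. Qed.

Lemma contentS k x p : content k x p.+1 = add_part k (content k x p) (x p).
Proof.
apply: (@eq_from_nth _ 0); rewrite !size_mkseq // => j lt_jk.
by rewrite !nth_mkseq // cntS eq_sym.
Qed.

Lemma eq_content k x y p :
  (forall i, i < p -> x i = y i) -> content k x p = content k y p.
Proof.
move=> xy; apply: (@eq_from_nth _ 0); rewrite !size_mkseq // => j lt_jk.
by rewrite !nth_mkseq // (eq_cnt _ xy).
Qed.

Lemma eq_weight q k x y n :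
  (forall i, i < n -> x i = y i) -> weight q k x n = weight q k y n.
Proof.
move=> xy; apply: eq_bigr => i _; rewrite xy // (@eq_content _ x y) // => j lt_j.
exact/xy/(ltn_trans lt_j).
Qed.

Definition word_rcons n k (w : {ffun 'I_n -> 'I_k.+1}) (l : 'I_k.+1) :
    {ffun 'I_n.+1 -> 'I_k.+1} :=
  [ffun i => if unlift ord_max i is Some j then w j else l].

Lemma letter_rcons_lt n k (w : {ffun 'I_n -> 'I_k.+1}) l p :
  p < n -> letter (word_rcons w l) p = letter w p.
Proof.
move=> lt_pn; rewrite /letter !insubT ?ltnS ?(ltnW lt_pn) //= => lt_pSn.
rewrite ffunE; set i : 'I_n := Sub p lt_pn.
suff -> : Sub p lt_pSn = lift ord_max i by rewrite liftK.
by apply: val_inj; rewrite /= /bump leqNgt lt_pn.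
Qed.

Lemma letter_rcons_last n k (w : {ffun 'I_n -> 'I_k.+1}) l :
  letter (word_rcons w l) n = l.
Proof.
rewrite /letter insubT //= => lt_nSn; rewrite ffunE.
suff -> : Sub n lt_nSn = ord_max by rewrite unlift_none.
exact: val_inj.
Qed.

Lemma sum_word_rcons n k (H : {ffun 'I_n.+1 -> 'I_k.+1} -> nat) :
  \sum_w H w = \sum_(w : {ffun 'I_n -> 'I_k.+1}) \sum_l H (word_rcons w l).
Proof.
rewrite pair_bigA (reindex (fun wl => word_rcons wl.1 wl.2)) //=.
exists (fun w : {ffun 'I_n.+1 -> 'I_k.+1} =>
  ([ffun i => w (lift ord_max i)] : {ffun 'I_n -> 'I_k.+1}, w ord_max)).
  case=> w l _; congr pair; last by rewrite ffunE unlift_none.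
  by apply/ffunP => i; rewrite !ffunE liftK.
move=> w _; apply/ffunP => i; rewrite ffunE /=.
by case: unliftP => [j ->|->]; rewrite ?ffunE.
Qed.

(** Induction on [n]: the first coordinate of the space supplies the last letter of the word. [Phi]
    is general so that the sum over this letter can be absorbed into a new function [Psi] of the
    smaller profile. *)
Lemma sum_profile_words (F : finFieldType) n k (A : 'M[F]_n)
    (Phi : seq nat -> nat) :
  0 < k -> is_diag_mx A -> injective (fun i => A i i) ->
  \sum_(W : {vspace 'cV[F]_n}) Phi (profile k (linfun (mulmx A)) W) =
  \sum_(w : {ffun 'I_n -> 'I_k.+1})
    weight #|F| k (letter w) n * Phi (content k (letter w) n).
Proof.
move=> k_gt0; elim: n A Phi => [|n IHn] A Phi diagA injA.
  have W0 (W : {vspace 'cV[F]_0}) : W = 0%VS.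
    apply/eqP; rewrite -dimv_eq0 -leqn0 (leq_trans (dimvS (subvf W))) //.
    by rewrite dimvf dim_matrix.
  rewrite (big_pred1 0%VS) => [|W]; last exact/esym/eqP/W0.
  rewrite (big_pred1 [ffun=> ord_max]) => [|w]; last first.
    by symmetry; apply/eqP/ffunP => -[].
  rewrite /weight big_ord0 mul1n; congr Phi.
  apply: (@eq_from_nth _ 0); rewrite !size_mkseq // => j lt_jk.
  rewrite !nth_mkseq // (W0 (krylov _ _ j.+1)) (W0 (krylov _ _ j)) subnn.
  by rewrite /cnt big_ord0.
rewrite (sum_profile_cons _ k_gt0 diagA injA) /=.
pose Psi nu := \sum_(l < k.+1) step #|F| k nu l * Phi (add_part k nu l).
rewrite (IHn _ Psi) => [||i j]; last 2 first.
- apply/is_diag_mxP => i j ij; rewrite !mxE; move/is_diag_mxP: diagA; apply.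
  by rewrite /= eqSS.
- by rewrite !mxE => /injA/(congr1 val)[/val_inj].
rewrite sum_word_rcons; apply: eq_bigr => w _; rewrite big_distrr /=.
apply: eq_bigr => l _; rewrite mulnA.
have eq_w i : i < n -> letter (word_rcons w l) i = letter w i.
  exact: letter_rcons_lt.
rewrite contentS /weight big_ord_recr /= letter_rcons_last.
by rewrite (eq_content _ eq_w) -!/(weight _ _ _ _) (eq_weight _ _ eq_w).
Qed.

(** If the letter [j.+1] is read when [j] and [j.+1] have equal counts, its factor [q ^ a - q ^ a]
    is zero. *)
Lemma weight_lattice q k x n : weight q k x n != 0 ->
  forall p j, p <= n -> j.+1 < k -> cnt x j.+1 p <= cnt x j p.
Proof.
move=> w_neq0 p j; elim: p => [|p IHp] lt_pn lt_jk.
  by rewrite /cnt !big_ord0.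
have := IHp (ltnW lt_pn) lt_jk; rewrite !cntS.
have [xp|_] := eqVneq (x p) j.+1; last lia.
rewrite leq_eqVlt => /predU1P[eq_cnt|]; last lia.
case/negP: w_neq0; rewrite /weight (bigD1 (Ordinal lt_pn)) //= xp /= lt_jk.
by rewrite !nth_mkseq ?(ltnW lt_jk) // eq_cnt subnn.
Qed.

(** * Tableaux as lattice words *)

(** A geometric sum when [b <= a]; when [a < b], truncated subtraction makes both sides zero. *)
Lemma sub_expn q a b :
  0 < q -> q ^ a - q ^ b = (q - 1) * q ^ b * qint q (a - b).
Proof.
move=> q_gt0; have [lt_ab|le_ba] := ltnP a b.
  rewrite (eqP (ltnW lt_ab)) /qint big_ord0 muln0; apply/eqP.
  by rewrite subn_eq0 leq_pexp2l // ltnW.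
rewrite mulnAC subn1 -predn_exp -[in LHS](subnK le_ba) expnD.
by rewrite -[X in _ - X]mul1n -mulnBl subn1.
Qed.

(** In a weakly decreasing sequence the parts larger than [i] form an initial segment. *)
Lemma lt_count_nth s i j :
  sorted geq s -> (j < count (leq i.+1) s) = (i < nth 0 s j).
Proof.
elim: s j => [|a s IHs] j /= sorted_s; first by rewrite nth_nil.
have {}IHs := IHs _ (path_sorted sorted_s).
have [lt_ia|le_ai] := ltnP i a.
  by case: j => [|j]; rewrite /= ?add1n ?ltnS ?IHs.
have s_le_a : all (geq a) s.
  by apply: order_path_min sorted_s => y x z; rewrite /geq /=; lia.
have -> : count (leq i.+1) s = 0.
  rewrite (eq_in_count (a2 := pred0)) ?count_pred0 // => x /(allP s_le_a) /=.
  lia.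
have [lt_js|le_sj] := ltnP j (size s).+1; last by rewrite nth_default // ltn0.
have : nth 0 (a :: s) j \in a :: s by apply: mem_nth.
rewrite inE => /predU1P[->|/(allP s_le_a) /=]; lia.
Qed.

(** * Cells of the conjugate shape, addressed by row and column *)

Section Words.
Variables (mu : seq nat) (n : nat).
Hypothesis mu_gt0 : 0 < size mu.
Hypothesis mu_part : is_partition mu.

Local Notation k := (size mu).
Local Notation lam := (conj_part mu).
Local Notation col := (@col_of lam).
Local Notation row := (@row_of lam).
Implicit Types (c : cell lam) (T : tableau n lam) (w : {ffun 'I_n -> 'I_k.+1}).

Lemma mu_sorted : sorted geq mu. Proof. by case/andP: mu_part. Qed.

Lemma nth_mu_gt0 j : j < k -> 0 < nth 0 mu j.
Proof. by move=> lt_jk; case/andP: mu_part => _ /(all_nthP 0)/(_ j lt_jk). Qed.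

Lemma nth_mu_le i j : i <= j -> nth 0 mu j <= nth 0 mu i.
Proof.
move=> le_ij; have [lt_jk|le_kj] := ltnP j k; last by rewrite nth_default.
have geq_tr : transitive geq by move=> y x z; rewrite /geq /=; lia.
have := sorted_leq_nth geq_tr leqnn 0 mu_sorted; apply=> //.
by rewrite inE (leq_ltn_trans le_ij).
Qed.

Lemma size_lam : size lam = nth 0 mu 0.
Proof. by rewrite size_mkseq nth0. Qed.

Lemma lt_nth_lam i j : i < size lam -> (j < nth 0 lam i) = (i < nth 0 mu j).
Proof.
rewrite size_mkseq => lt_i; rewrite nth_mkseq // lt_count_nth //.
exact: mu_sorted.
Qed.

Lemma head_lam : head 0 lam = k.
Proof.
have lt0 : 0 < size lam by rewrite size_lam nth_mu_gt0.
rewrite -nth0; apply/eqP; rewrite eqn_leq; apply/andP; split; rewrite leqNgt.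
  by rewrite lt_nth_lam // nth_default.
by apply/negP => /nth_mu_gt0; rewrite -lt_nth_lam // ltnn.
Qed.

Lemma row_lt c : row c < nth 0 mu (col c).
Proof. by case: c => i j; rewrite /row_of /col_of /= -lt_nth_lam. Qed.

Lemma col_lt c : col c < k.
Proof.
by case: (ltnP (col c) k) (row_lt c) => // le_kj; rewrite nth_default.
Qed.

Lemma cell_inj c c' : row c = row c' -> col c = col c' -> c = c'.
Proof.
case: c c' => [i j] [i' j']; rewrite /row_of /col_of /= => /val_inj ii'.
by case: i' / ii' j' => j' /val_inj ->.
Qed.

Lemma ex_cell i j : i < nth 0 mu j -> exists2 c, row c = i & col c = j.
Proof.
move=> lt_i.
have lt_ir : i < size lam by rewrite size_lam (leq_trans lt_i) ?nth_mu_le.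
have lt_jc : j < nth 0 lam (Ordinal lt_ir) by rewrite lt_nth_lam.
by exists (Tagged (fun i : 'I_(size lam) => 'I_(nth 0 lam i)) (Ordinal lt_jc)).
Qed.

Lemma sum_cells (G : nat -> nat -> nat) :
  \sum_c G (col c) (row c) = \sum_(j < k) \sum_(i < nth 0 mu j) G j i.
Proof.
transitivity (\sum_(i < size lam) \sum_(j < nth 0 lam i) G j i).
  by rewrite sig_big_dep /=.
transitivity (\sum_(i < size lam) \sum_(j < k | i < nth 0 mu j) G j i).
  apply: eq_bigr => i _; rewrite (big_ord_widen k (fun j => G j i)).
    by apply: eq_bigl => j; rewrite lt_nth_lam.
  by rewrite leqNgt lt_nth_lam // nth_default.
rewrite (exchange_big_dep xpredT) //=; apply: eq_bigr => j _.
by rewrite -(big_ord_widen (size lam) (G j)) // size_lam nth_mu_le.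
Qed.

(** This turns a row index into a number of cells, so that occurrence counts can be compared with
    rows as cardinals. *)
Lemma card_col_lt i j : i <= nth 0 mu j ->
  #|[set c | (col c == j) && (row c < i)]| = i.
Proof.
move=> le_i; rewrite -sum1_card big_mkcond /=.
under eq_bigr => c _ do rewrite inE.
rewrite (sum_cells (fun j' i' => if (j' == j) && (i' < i) then 1 else 0)).
have [lt_jk|le_kj] := ltnP j k; last first.
  move: le_i; rewrite nth_default // leqn0 => /eqP ->; rewrite big1 // => j' _.
  by rewrite big1 // => i' _; rewrite ltn0 andbF.
rewrite (bigD1 (Ordinal lt_jk)) //= eqxx [X in _ + X]big1 ?addn0 => [|j' j'j].
  by rewrite /= -big_mkcond /= -(big_ord_widen _ (fun=> 1)) // sum1_card card_ord.
by rewrite big1 // => i' _; rewrite -[_ == j]/(j' == Ordinal lt_jk) (negPf j'j).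
Qed.

Lemma multilinearP T : reflect
  [/\ injective T, forall c, 0 < T c,
      forall c c', row c = row c' -> col c < col c' -> T c < T c'
    & forall c c', col c = col c' -> row c < row c' -> T c < T c']
  (multilinear T).
Proof.
apply: (iffP and4P) => -[/injectiveP injT posT rowT colT]; split => //.
- exact/forallP.
- move=> c c' /eqP cc' lt_cc'; move/forallP/(_ c)/forallP/(_ c')/implyP: rowT.
  by rewrite cc'; apply.
- move=> c c' /eqP cc' lt_cc'; move/forallP/(_ c)/forallP/(_ c')/implyP: colT.
  by rewrite cc'; apply.
- exact/forallP.
- apply/forallP => c; apply/forallP => c'; apply/implyP => /andP[/eqP cc'].
  exact: rowT.
- apply/forallP => c; apply/forallP => c'; apply/implyP => /andP[/eqP cc'].
  exact: colT.
Qed.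

(** * From tableaux to words and back; the position [p] carries the entry [p.+1] *)

Definition word_of T : {ffun 'I_n -> 'I_k.+1} :=
  [ffun p : 'I_n => if [pick c | T c == p.+1 :> nat] is Some c
                    then inord (col c) else ord_max].

(** The cell in row [i] and column [j] receives the position of occurrence number [i.+1] of the
    letter [j]; [lift ord0] shifts positions to entries starting at 1. The default [ord0] is not a
    legal entry. *)
Definition tab_of w : tableau n lam :=
  [ffun c => if [pick p : 'I_n | (letter w p == col c)
                                 && (cnt (letter w) (col c) p == row c)]
             is Some p then lift ord0 p else ord0].

Lemma letterE w (p : 'I_n) : letter w p = w p.
Proof. by rewrite /letter valK. Qed.

Lemma word_of_some T c (p : 'I_n) : injective T -> T c = p.+1 :> nat ->
  letter (word_of T) p = col c.
Proof.
move=> injT Tc; rewrite letterE ffunE; case: pickP => [c' /eqP Tc'|/(_ c)].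
  have -> : c' = c by apply/injT/val_inj; rewrite /= Tc.
  by rewrite inordK // ltnS ltnW ?col_lt.
by rewrite Tc eqxx.
Qed.

Lemma word_of_none T (p : 'I_n) : (forall c, T c != p.+1 :> nat) ->
  letter (word_of T) p = k.
Proof.
move=> Tp; rewrite letterE ffunE; case: pickP => [c|//].
by rewrite (negPf (Tp c)).
Qed.

Lemma cnt_word_of T j p : multilinear T -> j < k -> p <= n ->
  cnt (letter (word_of T)) j p = #|[set c | (col c == j) && (T c <= p)]|.
Proof.
case/multilinearP => injT posT _ _ lt_jk; elim: p => [_|p IHp lt_pn].
  rewrite /cnt big_ord0; symmetry; apply: eq_card0 => c.
  by rewrite inE leqn0 -[X in X == 0]prednK ?andbF.
rewrite cntS (IHp (ltnW lt_pn)) -[p in letter _ p]/(val (Ordinal lt_pn)).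
set i := Ordinal lt_pn.
have [c /eqP Tc|Tp] := pickP (fun c => T c == p.+1 :> nat).
  rewrite (word_of_some (p := i) injT Tc) [RHS](cardsD1 c) inE Tc leqnn andbT.
  rewrite addnC; congr (_ + _); apply: eq_card => c'; rewrite !inE.
  have [->|cc'] /= := eqVneq c' c; first by rewrite Tc ltnn andbF.
  congr (_ && _); rewrite [RHS]leq_eqVlt ltnS.
  by rewrite -Tc val_eqE (inj_eq injT) (negPf cc').
rewrite (word_of_none (p := i)) => [|c]; last by rewrite Tp.
rewrite gtn_eqF // addn0; apply: eq_card => c; rewrite !inE; congr (_ && _).
by rewrite [RHS]leq_eqVlt Tp.
Qed.

(** Columns increase, so the entries of the same column smaller than [T c] are exactly those in the
    rows above. *)
Lemma cnt_row T c : multilinear T ->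
  cnt (letter (word_of T)) (col c) (T c).-1 = row c.
Proof.
move=> mT; case/multilinearP: (mT) => injT posT _ colT.
rewrite cnt_word_of ?col_lt //; last exact: leq_trans (leq_pred _) (leq_ord _).
rewrite -[RHS](card_col_lt (ltnW (row_lt c))).
apply: eq_card => c'; rewrite !inE.
have [cc' /=|//] := eqVneq (col c') (col c).
rewrite -ltnS prednK //; case: (ltngtP (row c') (row c)) => [lt|lt|eq].
- by rewrite (colT c' c).
- by rewrite ltnNge ltnW // (colT c c').
- by rewrite (cell_inj eq cc') ltnn.
Qed.

Lemma letter_cell T c : multilinear T -> letter (word_of T) (T c).-1 = col c.
Proof.
case/multilinearP => injT posT _ _.
have lt_p : (T c).-1 < n by rewrite -ltnS prednK.
by apply: (word_of_some (p := Ordinal lt_p)) => //=; rewrite prednK.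
Qed.

Lemma tab_ofK T : multilinear T -> tab_of (word_of T) = T.
Proof.
move=> mT; case/multilinearP: (mT) => injT posT _ _.
apply/ffunP => c; rewrite ffunE.
have lt_p : (T c).-1 < n by rewrite -ltnS prednK.
case: pickP => [p /andP[/eqP lp /eqP cp]|/(_ (Ordinal lt_p))]; last first.
  by rewrite /= letter_cell // cnt_row // !eqxx.
apply: val_inj; rewrite /= /bump leq0n add1n -[RHS]prednK //; congr _.+1.
have lc := letter_cell c mT; have cc := cnt_row c mT.
(* Two positions with the same letter and the same number of earlier occurrences of it coincide. *)
case: (ltngtP p (T c).-1) => // lt.
  by have := cnt_lt (letter (word_of T)) lt; rewrite lp cp cc ltnn.
by have := cnt_lt (letter (word_of T)) lt; rewrite lc cp cc ltnn.
Qed.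

Definition lattice w : bool :=
  [forall p : 'I_n.+1, forall j : 'I_k, (j.+1 < k) ==>
     (cnt (letter w) j.+1 p <= cnt (letter w) j p)].

Lemma latticeP w : reflect (forall p j, p <= n -> j.+1 < k ->
  cnt (letter w) j.+1 p <= cnt (letter w) j p) (lattice w).
Proof.
apply: (iffP forallP) => [lat p j le_pn lt_jk|lat p].
  by have /forallP/(_ (Ordinal (ltnW lt_jk)))/implyP/(_ lt_jk) := lat (inord p);
     rewrite inordK.
by apply/forallP => j; apply/implyP => lt_jk; rewrite lat // -ltnS.
Qed.

(** Moving a cell of column [j.+1] to its left neighbour is injective and decreases the entry, so
    column [j] has at least as many entries up to [p]. *)
Lemma lattice_word_of T : multilinear T -> lattice (word_of T).
Proof.
move=> mT; case/multilinearP: (mT) => injT posT rowT _.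
apply/latticeP => p j le_pn lt_jk; rewrite !cnt_word_of ?(ltnW lt_jk) //.
(* Stated for every cell, with a vacuous case outside column [j.+1], so that [xchoose] yields a
   total function. *)
have left_cell c : exists c',
    (col c == j.+1) ==> (row c' == row c) && (col c' == j).
  have [cj|_] := eqVneq (col c) j.+1; last by exists c.
  have [|c' rc' cc'] := @ex_cell (row c) j; last first.
    by exists c'; rewrite rc' cc' !eqxx.
  by rewrite (leq_trans (row_lt c)) // cj nth_mu_le.
pose L c := xchoose (left_cell c).
have LP c : col c = j.+1 -> row (L c) = row c /\ col (L c) = j.
  move=> /eqP cj; have /implyP/(_ cj) := xchooseP (left_cell c).
  by rewrite -/(L c) => /andP[/eqP -> /eqP ->].
rewrite -(card_in_imset (f := L)) => [|c c']; last first.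
  rewrite !inE => /andP[/eqP cj _] /andP[/eqP c'j _] LL.
  apply: cell_inj; last by rewrite cj.
  by rewrite -(LP c cj).1 -(LP c' c'j).1 LL.
apply/subset_leq_card/subsetP => _ /imsetP[c + ->]; rewrite !inE.
case/andP=> /eqP cj Tc; have [rL cL] := LP c cj; rewrite cL eqxx /=.
by apply: leq_trans Tc; apply/ltnW/rowT => //; rewrite cL cj.
Qed.

Lemma content_word_of T : multilinear T ->
  content k (letter (word_of T)) n = mu.
Proof.
move=> mT; apply: (@eq_from_nth _ 0); rewrite size_mkseq // => j lt_jk.
rewrite nth_mkseq // cnt_word_of // -[RHS](@card_col_lt (nth 0 mu j) j) //.
apply: eq_card => c; rewrite !inE -ltnS ltn_ord.
by case: eqP => //= <-; rewrite row_lt.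
Qed.

(** * Lattice words of content [mu] yield multilinear tableaux *)

Section ValidWord.
Variable w : {ffun 'I_n -> 'I_k.+1}.
Hypothesis w_content : content k (letter w) n = mu.
Hypothesis w_lattice : lattice w.

Lemma cnt_content j : j < k -> cnt (letter w) j n = nth 0 mu j.
Proof. by move=> lt_jk; rewrite -[in RHS]w_content nth_mkseq. Qed.

Lemma tab_ofP c : exists2 p : 'I_n, tab_of w c = p.+1 :> nat &
  letter w p = col c /\ cnt (letter w) (col c) p = row c.
Proof.
rewrite ffunE; case: pickP => [p /andP[/eqP lp /eqP cp]|no_p].
  by exists p.
have [|p lt_pn [lp cp]] := @cnt_surj (letter w) (col c) n (row c).
  by rewrite cnt_content ?col_lt ?row_lt.
by have := no_p (Ordinal lt_pn); rewrite /= lp cp !eqxx.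
Qed.

Lemma cnt_lattice i j p : i <= j -> j < k -> p <= n ->
  cnt (letter w) j p <= cnt (letter w) i p.
Proof.
move=> + + le_pn; elim: j => [|j IHj]; first by rewrite leqn0 => /eqP ->.
rewrite leq_eqVlt => /predU1P[->//|lt_ij] lt_jk.
by apply: leq_trans (IHj lt_ij (ltnW lt_jk)); move/latticeP: w_lattice; apply.
Qed.

Lemma multilinear_tab_of : multilinear (tab_of w).
Proof.
apply/multilinearP; split=> [c c'|c|c c' cc' lt|c c' cc' lt].
- move/(congr1 val) => /=; have [p -> [lp cp]] := tab_ofP c.
  have [p' -> [lp' cp']] := tab_ofP c' => -[/val_inj pp']; subst p'.
  have cc' : col c = col c' by rewrite -lp -lp'.
  by apply: cell_inj => //; rewrite -cp -cp' cc'.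
- by have [p -> _] := tab_ofP c.
- have [p -> [lp cp]] := tab_ofP c; have [p' -> [lp' cp']] := tab_ofP c'.
  (* Just after [p'] the letter [col c'] has occurred [(row c').+1] times, hence so has [col c] at
     least. As the letter at [p'] is not [col c], these occurrences all precede [p'], so
     [p < p']. *)
  rewrite ltnS; have := cnt_lattice (ltnW lt) (col_lt c') (ltn_ord p').
  rewrite !cntS cp' lp' eqxx (gtn_eqF lt) => le_cnt.
  rewrite ltnNge; apply/negP => /(cnt_le (letter w) (col c)); lia.
- have [p -> [lp cp]] := tab_ofP c; have [p' -> [lp' cp']] := tab_ofP c'.
  rewrite ltnS ltnNge; apply/negP => /(cnt_le (letter w) (col c)).
  by rewrite cp cc' cp' leqNgt lt.
Qed.

Lemma word_ofK : word_of (tab_of w) = w.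
Proof.
apply/ffunP => p; apply: val_inj; rewrite /= -!letterE.
have injT : injective (tab_of w) by case/multilinearP: multilinear_tab_of.
have [lt_lk|le_kl] := ltnP (letter w p) k.
  (* The cell whose row is the number of earlier occurrences of the letter at [p] must carry the
     entry [p.+1]. *)
  have [|c rc cc] := @ex_cell (cnt (letter w) (letter w p) p) (letter w p).
    by rewrite -cnt_content // cnt_lt.
  rewrite (@word_of_some _ c) //; have [p' -> [lp' cp']] := tab_ofP c.
  congr _.+1; rewrite cc rc in lp' cp'.
  case: (ltngtP p p') => // lt; have := cnt_lt (letter w) lt.
    by rewrite cp' ltnn.
  by rewrite lp' cp' ltnn.
rewrite word_of_none => [|c].
  by apply/eqP; rewrite eqn_leq le_kl letterE -ltnS ltn_ord.
have [p' -> [lp' _]] := tab_ofP c; apply: contraTneq le_kl => -[/val_inj <-].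
by rewrite lp' -ltnNge col_lt.
Qed.
End ValidWord.

(** * Comparison of the weights *)

Lemma c_cellE T c : multilinear T -> 0 < col c ->
  c_cell T c = cnt (letter (word_of T)) (col c).-1 (T c).-1 - row c.
Proof.
move=> mT col_gt0; case/multilinearP: (mT) => injT posT rowT colT.
have lt_jk := col_lt c; set j := (col c).-1.
have jE : j.+1 = col c by rewrite prednK.
rewrite cnt_word_of //; last 2 first.
- by rewrite -ltnS jE ltnW.
- exact: leq_trans (leq_pred _) (leq_ord _).
have le_row : row c <= nth 0 mu j.
  by rewrite ltnW // (leq_trans (row_lt c)) // -jE nth_mu_le.
rewrite -[X in _ - X](card_col_lt le_row) -cardsDS.
  apply: eq_card => c'; rewrite !inE -jE eqSS -[T c' <= _]ltnS prednK //.
  by case: eqP => /= _; rewrite ?andbF // -leqNgt.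
(* Every cell [c'] of the previous column above the row of [c] has a smaller entry than [c]: its
   right neighbour [d] lies above [c], so [T c' < T d < T c]. Removing these [row c] cells leaves
   those counted by [c_cell]. *)
apply/subsetP => c'; rewrite !inE => /andP[/eqP cj lt_r].
rewrite cj eqxx /= -ltnS prednK //.
have [d rd cd] := @ex_cell (row c') (col c) (ltn_trans lt_r (row_lt c)).
apply: (@ltn_trans (T d)); first by apply: rowT; rewrite ?cd ?cj ?jE ?rd // -jE.
by apply: colT; rewrite ?cd ?rd.
Qed.

Lemma mem_supp T (p : 'I_n) : multilinear T ->
  (lift ord0 p \in supp T) = (letter (word_of T) p < k).
Proof.
case/multilinearP=> injT _ _ _; apply/imsetP/idP => [[c _ Tc]|lt_lk].
  by rewrite (@word_of_some _ c) ?col_lt // -Tc /= /bump leq0n.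
have [c /eqP Tc|Tp] := pickP (fun c => T c == p.+1 :> nat).
  by exists c => //; apply: val_inj; rewrite /= Tc /bump leq0n.
by move: lt_lk; rewrite word_of_none ?ltnn // => c; rewrite Tp.
Qed.

Lemma ord0_supp T : multilinear T -> ord0 \notin supp T.
Proof.
case/multilinearP=> _ posT _ _; apply/imsetP => -[c _ T0].
by have := posT c; rewrite -T0.
Qed.

Lemma prod_positions_cells T (G : nat -> nat) : multilinear T ->
  \prod_(p < n | letter (word_of T) p < k) G p = \prod_c G (T c).-1.
Proof.
move=> mT; have injT : injective T by case/multilinearP: mT.
transitivity (\prod_(y in supp T) G y.-1).
  rewrite [RHS]big_mkcond big_ord_recl (negPf (ord0_supp mT)) /= mul1n.
  rewrite big_mkcond.
  by apply: eq_bigr => p _; rewrite mem_supp.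
rewrite big_imset; last by move=> c c' _ _; apply: injT.
by apply: eq_bigl => c; rewrite inE.
Qed.

(** Pairs are grouped by the non-entry [p.+1], whose letter is [k]; the entries of the last column
    below it are the earlier occurrences of [k.-1]. *)
Lemma gammaE T : multilinear T ->
  gamma T = \sum_(p < n | k <= letter (word_of T) p)
              cnt (letter (word_of T)) k.-1 p.
Proof.
move=> mT; have injT : injective T by case/multilinearP: mT.
set C := last_col T; set C' := interval1n n :\: supp T.
transitivity (\sum_(y in C') #|[set x in C | x < y]|).
  rewrite /gamma /beta -sum1_card.
  under [RHS]eq_bigr => y _ do rewrite -sum1_card.
  rewrite pair_big_dep /= (reindex (fun p => (p.2, p.1))) /=.
    by apply: eq_bigl => -[x y]; rewrite !inE /= -andbA andbCA.
  by exists (fun p => (p.2, p.1)) => -[].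
rewrite big_mkcond big_ord_recl !inE andbF /= add0n [RHS]big_mkcond.
apply: eq_bigr => p _; rewrite !inE mem_supp // andbT -leqNgt.
case: ifP => // _; rewrite cnt_word_of ?(ltnW (ltn_ord p)) ?prednK //.
rewrite -(card_imset _ injT); apply: eq_card => x; rewrite !inE.
apply/andP/imsetP => [[/imsetP[c + ->]]|[c + ->]]; rewrite inE ?head_lam.
  move/eqP=> ck lt_x; exists c => //; rewrite inE -ltnS -eqSS ck prednK // eqxx.
  by move: lt_x; rewrite /= /bump leq0n.
rewrite -eqSS prednK // => /andP[ck le_p]; split; last by rewrite /= /bump leq0n.
by apply/imsetP; exists c => //; rewrite inE head_lam.
Qed.

(** Letters [k] contribute the power [gamma T]. A cell outside the first column contributes [(q - 1)
    * q ^ row c * qint q (c_cell T c)] by [sub_expn], and the rows of column [j] sum to a binomial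
    coefficient; first-column cells contribute 1. *)
Lemma weight_word_of q T : 0 < q -> multilinear T ->
  weight q k (letter (word_of T)) n =
  (q - 1) ^ (\sum_(1 <= j < k) nth 0 mu j)
  * q ^ (\sum_(1 <= j < k) 'C(nth 0 mu j, 2)) * (c_q q T * q ^ gamma T).
Proof.
move=> q_gt0 mT; set x := letter (word_of T).
have le_xk (p : 'I_n) : x p <= k by rewrite /x letterE -ltnS.
rewrite /weight (bigID (fun p : 'I_n => x p < k)) /= mulnA.
congr (_ * _); last first.
  rewrite gammaE // expn_sum; apply: eq_big => p; rewrite -leqNgt // => le_kx.
  have -> : x p = k by apply/eqP; rewrite eqn_leq le_xk.
  rewrite -[X in step _ _ _ X](prednK mu_gt0) /step prednK // ltnn nth_mkseq //.
  by rewrite prednK.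
rewrite (prod_positions_cells (fun p => step q k (content k x p) (x p))) //.
have sum_pos (G : nat -> nat) : \sum_(1 <= j < k) \sum_(i < nth 0 mu j) G i =
    \sum_(c | 0 < col c) G (row c).
  rewrite [RHS]big_mkcond (sum_cells (fun j i => if 0 < j then G i else 0)).
  rewrite -(big_mkord xpredT
    (fun j => \sum_(i < nth 0 mu j) if 0 < j then G i else 0)).
  rewrite (@big_ltn _ _ _ 0) // [X in X + _]big1 // add0n.
  by apply: eq_big_nat => j /andP[j_gt0 _]; rewrite j_gt0.
have -> : \sum_(1 <= j < k) nth 0 mu j = \sum_(c | 0 < col c) 1.
  rewrite -(sum_pos (fun=> 1)).
  by apply: eq_bigr => j _; rewrite sum1_card card_ord.
have -> : \sum_(1 <= j < k) 'C(nth 0 mu j, 2) = \sum_(c | 0 < col c) row c.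
  rewrite -(sum_pos id); apply: eq_bigr => j _.
  by rewrite -bin2_sum big_mkord.
rewrite !expn_sum -!big_split [RHS]big_mkcond; apply: eq_bigr => c _ /=.
rewrite /x letter_cell //; case: ifP => [col_gt0|]; last by case: (col c).
rewrite c_cellE // -[in LHS](prednK col_gt0) /step prednK // col_lt.
rewrite !nth_mkseq ?col_lt //; last first.
  exact: leq_ltn_trans (leq_pred _) (col_lt c).
by rewrite sub_expn // expn1 cnt_row.
Qed.

(** The tableau sum is reindexed by words through [tab_of]. The remaining words contribute zero:
    either the content is wrong, or the lattice condition fails and the weight vanishes. *)
Lemma sum_tableaux_words q : 0 < q ->
  \sum_(w : {ffun 'I_n -> 'I_k.+1})
    weight q k (letter w) n * (content k (letter w) n == mu) =
  (q - 1) ^ (\sum_(1 <= j < k) nth 0 mu j)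
  * q ^ (\sum_(1 <= j < k) 'C(nth 0 mu j, 2))
  * \sum_(T : tableau n lam | multilinear T) c_q q T * q ^ gamma T.
Proof.
move=> q_gt0; rewrite big_distrr /= (reindex_onto _ _ tab_ofK) /=.
rewrite (bigID (fun w => (content k (letter w) n == mu) && lattice w)) /=.
rewrite [X in _ + X]big1 ?addn0 => [|w]; last first.
  rewrite negb_and; case: eqP => [_ /= nlat|//]; rewrite ?muln0 // muln1.
  apply: contraNeq nlat => w_neq0; apply/latticeP; exact: weight_lattice w_neq0.
apply: eq_big => w; last first.
  case/andP=> /eqP cw lw; rewrite -weight_word_of ?multilinear_tab_of //.
  by rewrite word_ofK // cw eqxx muln1.
apply/andP/andP => [[/eqP cw lw]|[mT /eqP <-]].
  by rewrite word_ofK // multilinear_tab_of.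
by rewrite content_word_of // lattice_word_of.
Qed.
End Words.

Theorem theorem4p21 (q : nat) (F : finFieldType) (hq : #|F| = q)
    (n : nat) (Delta : 'M[F]_n)
    (hdiag : is_diag_mx Delta) (hdist : injective (fun i : 'I_n => Delta i i))
    (mu : seq nat) (hk : 0 < size mu) (hmu : is_partition mu) :
  #|[set W : {vspace 'cV[F]_n} | partial_profile Delta mu W]| =
    (q - 1) ^ (\sum_(1 <= j < size mu) nth 0 mu j)
    * q ^ (\sum_(1 <= j < size mu) 'C(nth 0 mu j, 2))
    * \sum_(T : tableau n (conj_part mu) | multilinear T)
        c_q q T * q ^ gamma T.
Proof.
have q_gt0 : 0 < q by rewrite -hq; apply/card_gt0P; exists 0%R.
rewrite -sum_tableaux_words // -hq.
(* The test function is the indicator of the profile [mu], which turns the sum over subspaces into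
   the required count. *)
rewrite -(sum_profile_words (fun nu => (nu == mu) : nat) hk hdiag hdist).
rewrite -sum1_card big_mkcond; apply: eq_bigr => W _.
by rewrite inE partial_profileE; case: eqP.
Qed.
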